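(* Let $k\geq 2$ and let $s_1,\ldots,s_k\geq 2$ be integers. Let $G$ be any graph containing no cycles of length four with minimum degree at least $s_1+\cdots+s_k-(k-1)$. Then $V(G)$ can be partitioned into $k$ parts $V_1,\ldots,V_k$ such that, for each $i\in\{1,\ldots,k\}$, the subgraph of $G$ induced on $V_i$ has minimum degree at least $s_i$.
   Context: All graphs are finite and simple, with non-empty vertex set. ''Containing no cycles of length four'' means that $G$ has no (not necessarily induced) subgraph isomorphic to $C_4$. The parts of a partition are pairwise disjoint non-empty sets whose union is $V(G)$. *)

(* Defs.v *)
From mathcomp Require Import all_boot.

Set Implicit Arguments.
Unset Strict Implicit.
Unset Printing Implicit Defensive.

(* Finite simple graphs. The vertex set may be empty here; nonemptiness is a
   separate hypothesis where it is wanted. *)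
Record sgraph := SGraph {
  vertex :> finType;
  adj : rel vertex;
  adj_sym : symmetric adj;
  adj_irrefl : irreflexive adj }.

Definition degree (G : sgraph) (v : G) : nat := #|[set u : G | adj v u]|.

(* Every degree is less than #|G|, so the default value #|G| is never attained
   by a graph with at least one vertex, see [leq_min_degree] and
   [min_degree_attained]. The empty graph gets the value 0. *)
Definition min_degree (G : sgraph) : nat :=
  \big[minn/#|G|]_(v : G) degree v.

Section Induced.
Variables (G : sgraph) (A : {set G}).

Definition induced_adj : rel {v : G | v \in A} :=
  fun u v => adj (val u) (val v).

Lemma induced_adj_sym : symmetric induced_adj.
Proof. by move=> u v; apply: adj_sym. Qed.

Lemma induced_adj_irrefl : irreflexive induced_adj.
Proof. by move=> u; apply: adj_irrefl. Qed.

Definition induced : sgraph := SGraph induced_adj_sym induced_adj_irrefl.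

End Induced.

(* [ordS] is the successor modulo 4 on 'I_4. *)
Definition C4_adj : rel 'I_4 := fun i j => (j == ordS i) || (i == ordS j).

Lemma C4_adj_sym : symmetric C4_adj.
Proof. by move=> i j; rewrite /C4_adj orbC. Qed.

Lemma C4_adj_irrefl : irreflexive C4_adj.
Proof. by case=> [[|[|[|[|]]]]]. Qed.

Definition C4 : sgraph := SGraph C4_adj_sym C4_adj_irrefl.

(* G has a subgraph, not necessarily induced, isomorphic to H. *)
Definition has_subgraph (H G : sgraph) : Prop :=
  exists f : H -> G, injective f /\ (forall x y : H, adj x y -> adj (f x) (f y)).

Definition is_partition (T : finType) (k : nat) (V : 'I_k -> {set T}) : Prop :=
  [/\ forall i, V i != set0,
      forall i j, i != j -> [disjoint V i & V j]
    & \bigcup_i V i = [set: T]].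

Lemma degree_lt (G : sgraph) (v : G) : degree v < #|G|.
Proof.
rewrite /degree -cardsT; apply: proper_card; apply/properP; split.
  exact: subsetT.
by exists v; rewrite ?inE ?adj_irrefl.
Qed.

Lemma leq_min_degree (G : sgraph) (d : nat) : 0 < #|G| ->
  reflect (forall v : G, d <= degree v) (d <= min_degree G).
Proof.
move=> G0; apply: (iffP idP) => [dG v|dG].
  apply: (leq_trans dG); rewrite /min_degree.
  elim: (index_enum G) (mem_index_enum v) => // x r IHr.
  rewrite inE big_cons => /predU1P[<-|/IHr]; first exact: geq_minl.
  exact/leq_trans/geq_minr.
have [v0 _] := card_gt0P G0; rewrite /min_degree; elim/big_ind: _ => [|x y dx dy|v _]; last exact: dG.
  exact: leq_trans (dG v0) (ltnW (degree_lt v0)).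
by rewrite leq_min dx.
Qed.

Lemma min_degree_attained (G : sgraph) : 0 < #|G| ->
  exists v : G, min_degree G = degree v.
Proof.
move=> G0; have [v0 _] := card_gt0P G0.
case: (arg_minnP (@degree G) (erefl (predT v0))) => v _ vmin.
exists v; apply/eqP; rewrite eqn_leq; apply/andP; split.
  by move/(leq_min_degree _ G0): (leqnn (min_degree G)); apply.
by apply/(leq_min_degree _ G0) => u; apply: vmin.
Qed.

(* Main.v *)
Require Import Defs.
From mathcomp Require Import all_boot.
From mathcomp Require Import zify.

Set Implicit Arguments.
Unset Strict Implicit.
Unset Printing Implicit Defensive.

(** Splitting off one part at a time reduces the theorem to one set
    ([exists_stable_subset]): if the graph is C4-free, [2 <= s], and every
    vertex of [W] has more than [s] neighbours in [W], then some non-empty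
    proper subset [A] of [W] has all its inner degrees at least [s], while every
    vertex of [W] outside [A] has at most [s - 1] neighbours in [A]. The vertices
    outside [A] then keep enough neighbours outside [A] for the remaining parts.

    Let [e(A)] count the edges inside [A]. The sets to find are local maxima of
    [e(A) - s |A|], since deleting [x] changes this quantity by [s - deg_A x]
    and adding [y] changes it by [deg_A y - s]. The empty set and [W] are local
    maxima already; assuming that there is no other, one studies the saddle
    between them. A set with a non-empty feasible subset (inner degrees at least
    [s]) does not run down to the empty set along improving deletions; a meager
    set (no non-empty subset with all inner degrees above [s]) does not contain
    a region of the kind that [W] is. The optimal sets are the highest ones that
    are meager and contain a non-empty feasible set. Such a set is itself
    feasible; it has tight vertices (inner degree exactly [s]); and a tight
    vertex can be deleted at no cost as long as a feasible subset survives. If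
    its neighbour [u] is tight too, then [u] drops below [s] and deleting it as
    well would be a strict gain: so no non-empty feasible set survives the
    deletion of an end of an edge between tight vertices ([optimal_tight_edge]).

    Every contradiction comes from that principle, by exhibiting the surviving
    feasible set as [M :\: S] for a small explicit [S]. This is where C4 enters:
    two vertices have at most one common neighbour, so a vertex outside a
    set [S] that lies around a triangle or a star has very few neighbours in [S],
    and the few exceptional vertices are absorbed into [S] or excluded.

    A fork is a vertex of inner degree [s + 1] with two tight neighbours.
    Call an optimal set forkless if its tight vertices are pairwise non-adjacent
    and it has no fork. Deleting a tight vertex from a forkless set gives
    again a forkless set ([forkless_del]); as optimal sets always have tight
    vertices, infinite descent shows that there is no forkless set
    ([no_forkless]). Hence an optimal set [A] of maximal cardinality is a solution.
    Otherwise some [y] of [W] outside [A] would have [s] neighbours in [A], and by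
    maximality adding [y] would destroy meagerness; the resulting region of inner
    degrees above [s] around [y] would force adjacent tight vertices, and the
    tight neighbours of a fork, to be neighbours of [y]. Both are impossible in a
    C4-free graph ([strict_loose], [exists_stable_subset]), so that [A] would be
    forkless. *)

(** * Degrees inside a vertex set *)
Section DegreeInSet.
Variable G : sgraph.
Implicit Types (A B X Z : {set G}) (x y z : G).

Definition deg_in A x := #|[set u in A | adj x u]|.

Lemma adjC x y : adj x y = adj y x.
Proof. exact: adj_sym. Qed.

Lemma adj_neq x y : adj x y -> x != y.
Proof. by apply: contraL => /eqP->; rewrite adj_irrefl. Qed.

Lemma deg_in_sub A B x : A \subset B -> deg_in A x <= deg_in B x.
Proof.
move=> sAB; apply/subset_leq_card/subsetP => u; rewrite !inE => /andP[uA ->].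
by rewrite (subsetP sAB).
Qed.

Lemma deg_in_del A x y : y \in A -> deg_in A x = adj x y + deg_in (A :\ y) x.
Proof.
move=> yA; rewrite /deg_in (cardsD1 y) !inE yA /=; congr (_ + _).
by apply: eq_card => u; rewrite !inE andbA.
Qed.

Lemma deg_in_add A x y : y \notin A -> deg_in (y |: A) x = adj x y + deg_in A x.
Proof. by move=> yA; rewrite (@deg_in_del _ _ y) ?setU11 ?setU1K. Qed.

Lemma deg_in0 x : deg_in set0 x = 0.
Proof. by apply: eq_card0 => u; rewrite !inE. Qed.

Lemma deg_inD A B x : B \subset A -> deg_in A x = deg_in B x + deg_in (A :\: B) x.
Proof.
move=> sBA; rewrite /deg_in -(cardsID B); congr (_ + _); apply: eq_card => u.
  rewrite !inE -[in RHS]andbC; case: (boolP (u \in B)) => uB; last by rewrite !andbF.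
  by rewrite (subsetP sBA) ?andbT.
by rewrite !inE andbA.
Qed.

Lemma deg_in_gt0 A x : 0 < deg_in A x -> exists2 u, u \in A & adj x u.
Proof. by case/card_gt0P => u; rewrite inE => /andP[]; exists u. Qed.

Lemma deg_in_gt1 A x : 1 < deg_in A x ->
  exists u v, [/\ u \in A, v \in A, adj x u, adj x v & u != v].
Proof.
case/card_gt1P => u [v] [] /[!inE] /andP[uA xu] /andP[vA xv] uv.
by exists u, v.
Qed.

Lemma deg_in1 x y : deg_in [set y] x = adj x y.
Proof. by rewrite -(setU0 [set y]) deg_in_add ?inE // deg_in0 addn0. Qed.

Lemma deg_inU A B x : deg_in (A :|: B) x <= deg_in A x + deg_in B x.
Proof. by rewrite /deg_in setIdE setIUl -!setIdE leq_card_setU. Qed.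

Lemma deg_in3 a b c x :
  deg_in [set a; b; c] x <= adj x a + adj x b + adj x c.
Proof.
apply: leq_trans (deg_inU _ _ _) _; rewrite deg_in1 leq_add2r.
by apply: leq_trans (deg_inU _ _ _) _; rewrite !deg_in1.
Qed.

Lemma setD_neq0 A B x : B \subset A -> deg_in B x < deg_in A x -> A :\: B != set0.
Proof.
move=> sBA lt; have [u uAB _] : exists2 u, u \in A :\: B & adj x u.
  by apply: deg_in_gt0; have := deg_inD x sBA; lia.
by apply/set0Pn; exists u.
Qed.

Lemma sum_deg_in_del A x : x \in A ->
  \sum_(y in A) deg_in A y = 2 * deg_in A x + \sum_(y in A :\ x) deg_in (A :\ x) y.
Proof.
move=> xA; rewrite (big_setD1 x) //=.
under eq_bigr => y _ do rewrite (deg_in_del y xA).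
rewrite big_split /= addnA mul2n -addnn; congr (_ + _ + _).
rewrite (deg_in_del x xA) adj_irrefl add0n /deg_in -sum1_card.
rewrite big_mkcond [RHS]big_mkcond; apply: eq_bigr => y _ /=.
by rewrite !inE adjC; case: (y != x); case: (y \in A); case: (adj x y).
Qed.
End DegreeInSet.

(** * Feasible, meager and optimal sets *)
Section Landscape.
Variables (G : sgraph) (s : nat) (W : {set G}).
Implicit Types (A X Z K M S : {set G}) (x y z u v : G).

Hypothesis uniq_nbr : forall x y u v : G, x != y ->
  adj x u -> adj y u -> adj x v -> adj y v -> u = v.
Hypothesis s_ge2 : 1 < s.

Definition feasible A := [forall x in A, s <= deg_in A x].
Definition meager A := [forall X : {set G},
  (X \subset A) && (X != set0) ==> [exists x in X, deg_in X x <= s]].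
Definition viable A := [&& A \subset W, meager A &
  [exists Z : {set G}, [&& Z \subset A, Z != set0 & feasible Z]]].
(** Up to the constant [2 * s * #|G|] this is [2 * (e(A) - s |A|)], where [e(A)]
    is the number of edges inside [A]; counting [s] for the vertices outside [A]
    keeps it a natural number. *)
Definition weight A := \sum_(x in A) deg_in A x + 2 * s * #|~: A|.
Definition optimal A := viable A && [forall X, viable X ==> (weight X <= weight A)].

Lemma feasibleP A : reflect {in A, forall x, s <= deg_in A x} (feasible A).
Proof. exact: forall_inP. Qed.

Lemma feasibleD A S : S \subset A ->
  (forall x, x \in A -> x \notin S -> deg_in S x + s <= deg_in A x) ->
  feasible (A :\: S).
Proof.
move=> sSA h; apply/feasibleP => x; rewrite inE => /andP[xS xA].
by have := h x xA xS; rewrite (deg_inD x sSA); lia.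
Qed.

Lemma meager_sub A X : X \subset A -> meager A -> meager X.
Proof.
move=> sXA /forallP mA; apply/forallP => Y; apply/implyP => /andP[sYX Y0].
by have /implyP := mA Y; apply; rewrite (subset_trans sYX).
Qed.

Lemma not_meager A : ~~ meager A ->
  exists K, [/\ K \subset A, K != set0 & {in K, forall x, s < deg_in K x}].
Proof.
case/forallPn => K; rewrite negb_imply => /andP[/andP[sKA K0]].
rewrite negb_exists_in => /forall_inP KP; exists K; split=> // x /KP.
by rewrite -ltnNge.
Qed.

Lemma strict_not_meager A K : K \subset A -> K != set0 ->
  {in K, forall x, s < deg_in K x} -> ~~ meager A.
Proof.
move=> sKA K0 KP; apply/negP => /forallP/(_ K).
by rewrite sKA K0 => /existsP[x /andP[/KP]]; lia.
Qed.

Lemma viableI A Z : A \subset W -> meager A ->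
  Z \subset A -> Z != set0 -> feasible Z -> viable A.
Proof.
move=> sAW mA sZA Z0 fZ; apply/and3P; split=> //; apply/existsP; exists Z.
exact/and3P.
Qed.

Lemma weight_del A x : x \in A ->
  weight (A :\ x) + 2 * deg_in A x = weight A + 2 * s.
Proof.
move=> xA; rewrite /weight (sum_deg_in_del xA).
suff -> : #|~: (A :\ x)| = #|~: A|.+1 by lia.
by rewrite setCD setUC cardsU1 inE xA.
Qed.

(** Deleting one vertex costs every other vertex at most one neighbour, so a
    failure of meagerness always contains a feasible set avoiding any prescribed
    vertex. *)
Lemma strict_del_feasible K y : y \in K -> {in K, forall x, s < deg_in K x} ->
  feasible (K :\ y) /\ K :\ y != set0.
Proof.
move=> yK KP; split.
  apply/feasibleP => x; rewrite in_setD1 => /andP[_ /KP].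
  by rewrite (deg_in_del x yK); case: (adj x y); lia.
have [u uK yu] : exists2 u, u \in K & adj y u.
  by apply: deg_in_gt0; apply: leq_trans (KP _ yK); lia.
by apply/set0Pn; exists u; rewrite !inE uK eq_sym adj_neq.
Qed.

Lemma optimal_viable A : optimal A -> viable A.
Proof. by case/andP. Qed.

Lemma optimal_max A X : optimal A -> viable X -> weight X <= weight A.
Proof. by case/andP => _ /forallP/(_ X)/implyP. Qed.

Lemma optimal_heavy A X : optimal A -> viable X -> weight A <= weight X -> optimal X.
Proof.
move=> oA vX le; rewrite /optimal vX; apply/forallP => Y; apply/implyP => vY.
exact: leq_trans (optimal_max oA vY) le.
Qed.

Lemma optimal_sub A : optimal A -> A \subset W.
Proof. by case/andP => /and3P[]. Qed.

Lemma optimal_meager A : optimal A -> meager A.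
Proof. by case/andP => /and3P[]. Qed.

(** A vertex of inner degree below [s] lies in no feasible subset, so deleting it
    keeps the set viable, and it strictly increases the weight. *)
Lemma optimal_feasible A : optimal A -> feasible A.
Proof.
move=> oA; apply/feasibleP => x xA; rewrite leqNgt; apply/negP => lt_s.
have /and3P[sAW mA /existsP[Z /and3P[sZA Z0 fZ]]] := optimal_viable oA.
have sZx : Z \subset A :\ x.
  rewrite subsetD1 sZA; apply/negP => xZ.
  by have := feasibleP _ fZ x xZ; have := deg_in_sub x sZA; lia.
have sxA := subsetDl A [set x].
have := optimal_max oA (viableI (subset_trans sxA sAW) (meager_sub sxA mA) sZx Z0 fZ).
by have := weight_del xA; lia.
Qed.

Lemma optimal_deg A x : optimal A -> x \in A -> s <= deg_in A x.
Proof. by move/optimal_feasible/feasibleP; apply. Qed.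

Lemma optimal_del A Z x : optimal A -> x \in A -> deg_in A x = s ->
  Z \subset A :\ x -> Z != set0 -> feasible Z -> optimal (A :\ x).
Proof.
move=> oA xA dx sZ Z0 fZ; apply: (optimal_heavy oA); last first.
  by have := weight_del xA; lia.
have sxA := subsetDl A [set x].
apply: viableI sZ Z0 fZ; first exact: subset_trans (optimal_sub oA).
exact: meager_sub (optimal_meager oA).
Qed.

(** Deleting the tight vertex [x] is free, so if [Z] survived then [A :\ x] would
    be optimal, hence feasible; but its vertex [u] has degree [s - 1]. *)
Lemma optimal_tight_edge A Z x u : optimal A -> x \in A -> u \in A ->
  deg_in A x = s -> deg_in A u = s -> adj x u ->
  Z \subset A :\ x -> Z != set0 -> feasible Z -> False.
Proof.
move=> oA xA uA dx du xu sZ Z0 fZ.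
have uAx : u \in A :\ x by rewrite !inE uA eq_sym adj_neq.
have := optimal_deg (optimal_del oA xA dx sZ Z0 fZ) uAx.
by have := deg_in_del u xA; rewrite adjC xu; lia.
Qed.

(** Meagerness of [A] itself gives a vertex of degree at most [s]. *)
Lemma optimal_tight A : optimal A -> exists2 x, x \in A & deg_in A x = s.
Proof.
move=> oA; have /and3P[_ /forallP/(_ A)] := optimal_viable oA.
rewrite subxx => /implyP h /existsP[Z /and3P[sZA Z0 _]].
have /existsP[x /andP[xA le]] : [exists x in A, deg_in A x <= s].
  by apply: h; apply: contraNneq Z0 => A0; rewrite -subset0 -A0.
by exists x => //; apply/eqP; rewrite eqn_leq le optimal_deg.
Qed.

(** * Loose and forkless sets *)

(** In a loose set every tight vertex can be deleted: its neighbours are not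
    tight, so the rest is still feasible. *)
Definition loose A := optimal A /\
  {in A &, forall x u, deg_in A x = s -> deg_in A u = s -> ~~ adj x u}.

Lemma loose_del A x : loose A -> x \in A -> deg_in A x = s -> optimal (A :\ x).
Proof.
case=> oA iA xA dx.
have [u uA xu] : exists2 u, u \in A & adj x u by apply: deg_in_gt0; lia.
apply: (optimal_del oA xA dx (subxx _)).
  by apply/set0Pn; exists u; rewrite !inE uA eq_sym adj_neq.
apply/feasibleP => y; rewrite !inE => /andP[yx yA].
have := optimal_deg oA yA; have := deg_in_del y xA.
have := iA x y xA yA dx; rewrite (adjC x); case: (adj y x) => //=; last lia.
by move=> h; case: (ltngtP (deg_in A y) s) h => // [|e h]; [|have := h e]; lia.
Qed.

Definition forkless A := loose A /\
  forall z v w, z \in A -> v \in A -> w \in A -> deg_in A z = s.+1 ->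
    deg_in A v = s -> deg_in A w = s -> adj z v -> adj z w -> v = w.

(** [K :\ y] is feasible and survives the deletion of any vertex outside [K], so
    by [optimal_tight_edge] both ends of an edge [z u] between tight vertices lie
    in [K]; having degree above [s] there, they are adjacent to [y]. Thus all
    tight vertices with a tight neighbour are in the neighbourhood of [y], and
    since [y] is the only common neighbour of [z] and [u], deleting both leaves
    a feasible set, which is impossible. *)
Lemma strict_loose A K y : optimal A -> y \notin A -> K \subset y |: A ->
  K != set0 -> {in K, forall x, s < deg_in K x} -> loose A.
Proof.
move=> oA yA sK K0 KP; split=> // z u zA uA dz du; apply/negP => zu.
have yK : y \in K.
  apply: contraT => yK; have := optimal_meager oA; apply: contraLR => _.
  apply: strict_not_meager K0 KP; apply/subsetP => x xK.
  have := subsetP sK x xK; rewrite !inE => /predU1P[xy|//].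
  by rewrite xy (negbTE yK) in xK.
have [fK Kn0] := strict_del_feasible yK KP.
have sKA : K :\ y \subset A by rewrite subDset.
(* Tight vertices with a tight neighbour lie in [K], hence are adjacent to [y]. *)
have tight_adj z' u' : z' \in A -> u' \in A -> deg_in A z' = s ->
    deg_in A u' = s -> adj z' u' -> adj y z'.
  move=> z'A u'A dz' du' zu'.
  have z'K : z' \in K.
    apply: contraT => z'K; case: (optimal_tight_edge oA z'A u'A dz' du' zu' _ Kn0 fK).
    by rewrite subsetD1 sKA !inE (negbTE z'K) andbF.
  have := KP _ z'K; have := deg_in_sub z' sK; rewrite deg_in_add // dz' adjC.
  case: (adj y z'); first by [].
  rewrite add0n => le lt.
  by have := leq_trans lt le; rewrite ltnn.
have yz := tight_adj z u zA uA dz du zu.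
have yu : adj y u by apply: (tight_adj u z) => //; rewrite adjC.
have sS : [set z; u] \subset A by rewrite subUset !sub1set zA uA.
have degS x : deg_in [set z; u] x <= adj x z + adj x u.
  by rewrite -!deg_in1 deg_inU.
apply: (optimal_tight_edge oA zA uA dz du zu (Z := A :\: [set z; u])).
- by rewrite setDS // sub1set !inE eqxx.
- apply: (setD_neq0 (x := z)) => //; have := degS z.
  by move: s_ge2; rewrite adj_irrefl dz zu; clear; lia.
apply: feasibleD => // x xA; rewrite !inE negb_or => /andP[xz xu].
have xy : x != y by apply: contraNneq yA => <-.
have := degS x; have dx := optimal_deg oA xA.
have nboth : ~~ (adj x z && adj x u).
  apply/negP => /andP[xz' xu']; have := uniq_nbr xy xz' yz xu' yu.
  by move=> e; move: zu; rewrite e adj_irrefl.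
have nz : adj x z -> deg_in A x != s.
  move=> xz'; apply/eqP => dxs; case/eqP: xu.
  apply: (uniq_nbr (x := y) (y := z)) => //; last by rewrite adjC.
    by rewrite eq_sym; apply: contraNneq yA => <-.
  exact: (tight_adj x z).
have nu : adj x u -> deg_in A x != s.
  move=> xu'; apply/eqP => dxs; case/eqP: xz.
  apply: (uniq_nbr (x := y) (y := u)) => //; try by rewrite adjC.
    by rewrite eq_sym; apply: contraNneq yA => <-.
  exact: (tight_adj x u).
move: nboth nz nu dx; clear; case: (adj x z); case: (adj x u) => //= _; last lia.
  by move=> /(_ isT); lia.
by move=> _ /(_ isT); lia.
Qed.

(** If deleting [v] makes adjacent [z] and [w] tight, then, in the absence of
    forks, both have degree [s + 1] and form a triangle with [v]. By
    C4-freeness no other vertex has two neighbours in the triangle, and by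
    forklessness no tight vertex has any, so the complement of the triangle is
    feasible. *)
Lemma forkless_loose_del M v : forkless M -> v \in M -> deg_in M v = s -> loose (M :\ v).
Proof.
case=> lM nM vM dv; have [oM iM] := lM; have oMv := loose_del lM vM dv.
split=> // z w /[!inE] /andP[zv zM] /andP[wv wM]; have := deg_in_del z vM.
have := deg_in_del w vM => + + dz dw; rewrite dz dw => dMw dMz.
apply/negP => zw; have wz : adj w z by rewrite adjC.
have [zv'|zv'] := boolP (adj z v); have [wv'|wv'] := boolP (adj w v);
  rewrite ?zv' ?wv' ?(negbTE zv') ?(negbTE wv') ?add0n ?add1n in dMz dMw.
- have sS : [set v; z; w] \subset M by rewrite !subUset !sub1set vM zM wM.
  have vz : adj v z by rewrite adjC.
  have vw : adj v w by rewrite adjC.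
  have zMv : z \in M :\ v by rewrite !inE zv.
  have wMv : w \in M :\ v by rewrite !inE wv.
  apply: (optimal_tight_edge oMv zMv wMv dz dw zw (Z := M :\: [set v; z; w])).
  + by rewrite setDDl setDS // subUset !sub1set !inE !eqxx ?orbT.
  + apply: (setD_neq0 (x := z)) => //; have := deg_in3 v z w z.
    by move: s_ge2; rewrite adj_irrefl zv' zw dMz; clear; lia.
  apply: feasibleD => // x xM; rewrite !inE !negb_or => /andP[/andP[xv xz] xw].
  have := deg_in3 v z w x; have := optimal_deg oM xM.
  have n1 : ~~ (adj x v && adj x z).
    apply/negP => /andP[a b]; case/eqP: (adj_neq vz).
    by apply: (uniq_nbr xw).
  have n2 : ~~ (adj x v && adj x w).
    apply/negP => /andP[a b]; case/eqP: (adj_neq vw).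
    by apply: (uniq_nbr xz).
  have n3 : ~~ (adj x z && adj x w).
    apply/negP => /andP[a b]; case/eqP: (adj_neq zw).
    by apply: (uniq_nbr xv).
  have t1 : deg_in M x = s -> ~~ adj x v by move/iM; apply.
  have t2 : deg_in M x = s -> ~~ adj x z.
    move=> dx; apply: contra xv => xz'; apply/eqP.
    by apply: (nM z) => //; rewrite adjC.
  have t3 : deg_in M x = s -> ~~ adj x w.
    move=> dx; apply: contra xv => xw'; apply/eqP.
    by apply: (nM w) => //; rewrite adjC.
  have [dx|dx] := eqVneq (deg_in M x) s.
    by rewrite (negbTE (t1 dx)) (negbTE (t2 dx)) (negbTE (t3 dx)) dx; clear; lia.
  move: n1 n2 n3 dx; clear.
  by case: (adj x v); case: (adj x z); case: (adj x w) => //=; lia.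
- by case/eqP: wv; apply: (nM z).
- by case/eqP: zv; apply: (nM w).
- by have := iM z w zM wM dMz dMw; rewrite zw.
Qed.

(** The set [S] consists of the fork [z], its tight neighbours [N], and the
    vertices [P] of degree [s + 1] forming a triangle with [z] and a member of
    [N]. As [S] lies in the closed neighbourhood of [z], a vertex other than [z]
    has at most one neighbour in [S :\ z]. So the complement of [S] is feasible,
    unless some [w] in [P] has a tight neighbour [r] besides its neighbour [c] in
    [N]. Hence a fork of a loose set always has a second fork [w] next to it, and
    the two share a tight neighbour [c]. *)
Lemma fork_partner M z v1 v2 : loose M -> z \in M -> v1 \in M -> v2 \in M ->
  v1 != v2 -> deg_in M z = s.+1 -> deg_in M v1 = s -> deg_in M v2 = s ->
  adj z v1 -> adj z v2 ->
  ~ (forall c w r, c \in M -> w \in M -> r \in M -> deg_in M c = s ->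
      deg_in M w = s.+1 -> deg_in M r = s -> adj z c -> adj z w -> adj w c ->
      adj w r -> r = c).
Proof.
move=> lM zM v1M v2M v12 dz dv1 dv2 zv1 zv2 noP; have [oM iM] := lM.
pose N := [set v in M | (deg_in M v == s) && adj z v].
pose P := [set w in M | [&& deg_in M w == s.+1, adj z w & [exists v in N, adj w v]]].
pose S := z |: (N :|: P).
have NP v : v \in N -> [/\ v \in M, deg_in M v = s & adj z v].
  by rewrite inE => /and3P[? /eqP].
have PP w : w \in P -> [/\ w \in M, deg_in M w = s.+1, adj z w &
    exists2 v, v \in N & adj w v].
  by rewrite inE => /and4P[? /eqP ? ? /exists_inP].
have SzP u : u \in N :|: P -> adj z u.
  by rewrite inE => /orP[/NP[]|/PP[]].
have zNP : z \notin N :|: P by apply/negP => /SzP; rewrite adj_irrefl.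
have degS x : deg_in S x = adj x z + deg_in (N :|: P) x by rewrite deg_in_add.
have degNP x : x != z -> deg_in (N :|: P) x <= 1.
  move=> xz; rewrite leqNgt; apply/negP => /deg_in_gt1[u [v [uS vS xu xv /eqP uv]]].
  by apply: uv; apply: (uniq_nbr xz) => //; apply: SzP.
have sSM : S \subset M.
  apply/subsetP => u /setU1P[->//|]; rewrite inE => /orP[/NP[]//|/PP[]//].
have v1N : v1 \in N by rewrite inE v1M dv1 eqxx.
have v2N : v2 \in N by rewrite inE v2M dv2 eqxx.
have fS : feasible (M :\: S).
  apply: feasibleD => // x xM; rewrite !inE !negb_or => /andP[xz /andP[xN xP]].
  have xnN : x \notin N by rewrite inE.
  have xnP : x \notin P by rewrite inE.
  rewrite degS; have := degNP x xz; have := optimal_deg oM xM.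
  have [dx|dx] := eqVneq (deg_in M x) s.
    have -> : adj x z = false.
      by apply: contraNF xnN => xz'; rewrite inE xM dx eqxx adjC.
    suff -> : deg_in (N :|: P) x = 0 by rewrite dx.
    apply/eqP; rewrite -leqn0 leqNgt; apply/negP => /deg_in_gt0[u + xu].
    rewrite inE => /orP[/NP[uM du _]|/PP[uM du zu [v vN uv]]].
      by have := iM x u xM uM dx du; rewrite xu.
    have [vM dv zv] := NP v vN.
    have e : x = v by apply: (noP v u x) => //; rewrite adjC.
    by rewrite e vN in xnN.
  have [dx1|dx1] := eqVneq (deg_in M x) s.+1; last first.
    by move: dx dx1; clear; case: (adj x z); lia.
  case: (boolP (adj x z)) => xz'; last by rewrite dx1; clear; lia.
  suff -> : deg_in (N :|: P) x = 0 by rewrite dx1.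
  apply/eqP; rewrite -leqn0 leqNgt; apply/negP => /deg_in_gt0[u + xu].
  have zx : adj z x by rewrite adjC.
  rewrite inE => /orP[uN|/PP[uM du zu [v vN uv]]].
    by case/negP: xnP; rewrite inE xM dx1 eqxx zx; apply/exists_inP; exists u.
  have [vM dv zv] := NP v vN.
  have e : x = v.
    by apply: (uniq_nbr (adj_neq zu)) => //; rewrite adjC.
  by rewrite e vN in xnN.
have Sn0 : M :\: S != set0.
  have v1z : v1 != z by rewrite eq_sym adj_neq.
  have [d0|] := posnP (deg_in (N :|: P) v1).
    apply: (setD_neq0 (x := v1)) => //; rewrite degS d0 dv1.
    by move: s_ge2; clear; case: (adj v1 z); lia.
  case/deg_in_gt0 => u + v1u; rewrite inE => /orP[/NP[uM du _]|/PP[uM du zu _]].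
    by have := iM v1 u v1M uM dv1 du; rewrite v1u.
  apply: (setD_neq0 (x := u)) => //; rewrite degS du.
  have uz : u != z by rewrite eq_sym adj_neq.
  by move: (degNP u uz) s_ge2; clear; case: (adj u z); lia.
have oM1 := loose_del lM v1M dv1.
have v2M1 : v2 \in M :\ v1 by rewrite !inE eq_sym v12.
have zM1 : z \in M :\ v1 by rewrite !inE adj_neq.
apply: (optimal_tight_edge oM1 v2M1 zM1 (Z := M :\: S)) => //.
- have := iM v2 v1 v2M v1M dv2 dv1; have := deg_in_del v2 v1M; rewrite dv2.
  by case: (adj v2 v1).
- by have := deg_in_del z v1M; rewrite dz zv1 => -[].
- by rewrite adjC.
- by rewrite setDDl setDS // subUset !sub1set !inE v1M v2M dv1 dv2 zv1 zv2 !eqxx !orbT.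
Qed.

(** Deleting [c] rather than [u] from [M] also gives a loose set. If [u] were not
    adjacent to [c], this would require [u] to hit each edge of the path
    [v z w r], which creates a C4. So [u] is adjacent to [c], and C4-freeness
    excludes the other four adjacencies. *)
Lemma fork_shape M u z c w v r : forkless M -> u \in M -> deg_in M u = s ->
  z \in M :\ u -> c \in M :\ u -> w \in M :\ u -> v \in M :\ u -> r \in M :\ u ->
  deg_in (M :\ u) z = s.+1 -> deg_in (M :\ u) w = s.+1 ->
  deg_in (M :\ u) c = s -> deg_in (M :\ u) v = s -> deg_in (M :\ u) r = s ->
  adj z c -> adj z w -> adj w c -> v != c -> r != c -> adj z v -> adj w r ->
  [/\ adj c u, ~~ adj z u, ~~ adj w u, ~~ adj v u & ~~ adj r u].
Proof.
move=> gM uM du; rewrite !inE => /andP[zu zM] /andP[cu cM] /andP[wu wM].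
move=> /andP[vu vM] /andP[ru rM] dz dw dc dv dr zc zw wc vc rc zv wr.
have [[oM iM] _] := gM; have lMu := forkless_loose_del gM uM du; have [_ iMu] := lMu.
have ne a b : deg_in (M :\ u) a = s.+1 -> deg_in (M :\ u) b = s -> a != b.
  by move=> da db; apply: contra_eq_neq da => ->; rewrite db neq_ltn ltnSn.
have zr := ne z r dz dr; have wv := ne w v dw dv.
have nzw : ~~ (adj z u && adj w u).
  apply/negP => /andP[a b]; case/eqP: cu.
  by apply: (uniq_nbr (adj_neq zw)).
have nzr : ~~ (adj z u && adj r u).
  by apply/negP => /andP[a b]; case/eqP: wu; apply: (uniq_nbr zr) => //; rewrite adjC.
have nwv : ~~ (adj w u && adj v u).
  apply/negP => /andP[a b]; case/eqP: zu.
  by apply: (uniq_nbr wv) => //; rewrite adjC.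
have cuA : adj c u.
  apply: contraT => ncu.
  have dcM : deg_in M c = s by rewrite (deg_in_del c uM) (negbTE ncu).
  have [_ iMc] := forkless_loose_del gM cM dcM.
  have dMc a : deg_in (M :\ c) a + adj a c = deg_in (M :\ u) a + adj a u.
    by have := deg_in_del a uM; have := deg_in_del a cM; clear; lia.
  have nvc : adj v c = false by apply/negbTE; apply: iMu; rewrite ?inE ?vu ?cu.
  have nrc : adj r c = false by apply/negbTE; apply: iMu; rewrite ?inE ?ru ?cu.
  have e1 : ~~ adj v u -> deg_in (M :\ c) v = s.
    by move=> /negbTE h; have := dMc v; rewrite nvc h dv !addn0.
  have e2 : ~~ adj r u -> deg_in (M :\ c) r = s.
    by move=> /negbTE h; have := dMc r; rewrite nrc h dr !addn0.
  have e3 : ~~ adj z u -> deg_in (M :\ c) z = s.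
    by move=> /negbTE h; have := dMc z; rewrite zc h dz addn0 addn1 => -[].
  have e4 : ~~ adj w u -> deg_in (M :\ c) w = s.
    by move=> /negbTE h; have := dMc w; rewrite wc h dw addn0 addn1 => -[].
  have zMc : z \in M :\ c by rewrite !inE adj_neq.
  have wMc : w \in M :\ c by rewrite !inE adj_neq.
  have vMc : v \in M :\ c by rewrite !inE vc.
  have rMc : r \in M :\ c by rewrite !inE rc.
  have hit a b : a \in M :\ c -> b \in M :\ c -> adj a b ->
      (~~ adj a u -> deg_in (M :\ c) a = s) ->
      (~~ adj b u -> deg_in (M :\ c) b = s) -> adj a u || adj b u.
    move=> aMc bMc ab ea eb; apply: contraT; rewrite negb_or => /andP[/ea da /eb db].
    by have := iMc a b aMc bMc da db; rewrite ab.
  move: (hit z v zMc vMc zv e3 e1) (hit z w zMc wMc zw e3 e4) (hit w r wMc rMc wr e4 e2).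
  move: nzw nzr nwv; clear.
  by case: (adj z u); case: (adj w u); case: (adj v u); case: (adj r u).
split=> //.
- apply/negP => zuA; case/eqP: wu.
  by apply: (uniq_nbr (adj_neq zc)) => //; rewrite adjC.
- apply/negP => wuA; case/eqP: zu.
  by apply: (uniq_nbr (adj_neq wc)) => //; rewrite adjC.
- apply/negP => vuA; case/eqP: zu.
  by apply: (uniq_nbr vc) => //; rewrite adjC.
- apply/negP => ruA; case/eqP: wu.
  by apply: (uniq_nbr rc) => //; rewrite adjC.
Qed.

(** The fork [z] and its partner form the configuration of [fork_shape], in which
    [u] is not adjacent to [z]. *)
Lemma fork_avoid M u z v1 v2 : forkless M -> u \in M -> deg_in M u = s ->
  z \in M :\ u -> v1 \in M :\ u -> v2 \in M :\ u -> v1 != v2 ->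
  deg_in (M :\ u) z = s.+1 -> deg_in (M :\ u) v1 = s -> deg_in (M :\ u) v2 = s ->
  adj z v1 -> adj z v2 -> ~~ adj z u.
Proof.
move=> gM uM du zM v1M v2M v12 dz dv1 dv2 zv1 zv2; apply/negP => zuA.
have lMu := forkless_loose_del gM uM du.
apply: (fork_partner lMu zM v1M v2M v12 dz dv1 dv2 zv1 zv2).
move=> c w r cM wM rM dc dw dr zc zw wc wr; apply/eqP/negPn/negP => rc.
have [e|v1c] := eqVneq v1 c.
  have v2c : v2 != c by rewrite -e eq_sym.
  have [] := fork_shape gM uM du zM cM wM v2M rM dz dw dc dv2 dr zc zw wc v2c rc zv2 wr.
  by rewrite zuA.
have [] := fork_shape gM uM du zM cM wM v1M rM dz dw dc dv1 dr zc zw wc v1c rc zv1 wr.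
by rewrite zuA.
Qed.

(** Suppose that deleting [u] creates a fork [z], with partner [w] and common
    tight neighbour [c]. By [fork_shape], the vertices [z], [w], [c] form a
    triangle of vertices of degree [s + 1] in [M], with respective tight pendant
    neighbours [v], [r], [u]. Let [S] be the set of these six vertices. A vertex
    outside [S] that has too many neighbours in [S] would be, up to C4s, a fork
    of [M], a degree [s + 1] vertex forming a triangle with a pendant edge (which
    would contradict [forkless_loose_del]), or a vertex of degree [s + 2] adjacent
    to all three pendant vertices, which [fork_avoid] excludes. So [M :\: S] is
    feasible. *)
Lemma forkless_del M u : forkless M -> u \in M -> deg_in M u = s -> forkless (M :\ u).
Proof.
move=> gM uM du; have lMu := forkless_loose_del gM uM du; split=> //.
move=> z v1 v2 zMu v1Mu v2Mu dz dv1 dv2 zv1 zv2; apply/eqP/negPn/negP => v12.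
apply: (fork_partner lMu zMu v1Mu v2Mu v12 dz dv1 dv2 zv1 zv2).
move=> c w r cMu wMu rMu dc dw dr zc zw wc wr; apply/eqP/negPn/negP => rc.
have [v [vMu dv zv vc]] :
    exists v, [/\ v \in M :\ u, deg_in (M :\ u) v = s, adj z v & v != c].
  have [e|v1c] := eqVneq v1 c; last by exists v1.
  by exists v2; rewrite -e eq_sym.
have [cuA zuA wuA vuA ruA] :=
  fork_shape gM uM du zMu cMu wMu vMu rMu dz dw dc dv dr zc zw wc vc rc zv wr.
have [[oM iM] nM] := gM; have [_ iMu] := lMu.
have dM a : deg_in M a = adj a u + deg_in (M :\ u) a := deg_in_del a uM.
have dzM : deg_in M z = s.+1 by rewrite dM (negbTE zuA).
have dwM : deg_in M w = s.+1 by rewrite dM (negbTE wuA).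
have dcM : deg_in M c = s.+1 by rewrite dM cuA dc.
have dvM : deg_in M v = s by rewrite dM (negbTE vuA).
have drM : deg_in M r = s by rewrite dM (negbTE ruA).
have sub a : a \in M :\ u -> (a != u) * (a \in M) by rewrite !inE => /andP[].
have [[zu zM] [wu wM] [cu cM] [vu vM] [ru rM]] :=
  And5 (sub z zMu) (sub w wMu) (sub c cMu) (sub v vMu) (sub r rMu).
have sym (a b : G) : adj a b -> adj b a by rewrite adjC.
have ne a b : deg_in M a = s.+1 -> deg_in M b = s -> a != b.
  by move=> da db; apply: contra_eq_neq da => ->; rewrite db neq_ltn ltnSn.
have vr : v != r.
  apply: contraNneq rc => e; apply/eqP; apply: (uniq_nbr (adj_neq zw)) => //.
  by rewrite -e.
have nvw : ~~ adj v w.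
  apply: contra vc => vw; apply/eqP.
  by apply: (uniq_nbr (adj_neq zw)) => //; apply: sym.
have nvc : ~~ adj v c by apply: iMu.
have nvr : ~~ adj v r by apply: iMu.
pose S := [set z; w; c] :|: [set v; r; u].
have degS x : deg_in S x <=
    adj x z + adj x w + adj x c + (adj x v + adj x r + adj x u).
  exact: leq_trans (deg_inU _ _ _) (leq_add (deg_in3 _ _ _ _) (deg_in3 _ _ _ _)).
have sSM : S \subset M by rewrite !subUset !sub1set zM wM cM vM rM uM.
have oMc : optimal (M :\ u :\ c) by apply: loose_del.
have zMc : z \in M :\ u :\ c by rewrite in_setD1 zMu adj_neq.
have vMc : v \in M :\ u :\ c by rewrite in_setD1 vMu vc.
apply: (optimal_tight_edge oMc vMc zMc (Z := M :\: S)).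
- by have := deg_in_del v cMu; rewrite dv (negbTE nvc).
- by have := deg_in_del z cMu; rewrite dz zc => -[].
- exact: sym.
- by rewrite !setDDl setDS // !subUset !sub1set !inE !eqxx !orbT.
- apply: (setD_neq0 (x := v)) => //; have := degS v; rewrite dvM adj_irrefl.
  rewrite (negbTE nvw) (negbTE nvc) (negbTE nvr) (negbTE vuA).
  by move: s_ge2; clear; case: (adj v z); lia.
apply: feasibleD => // x xM.
rewrite !inE !negb_or => /andP[/andP[/andP[xz xw] xc] /andP[/andP[xv xr] xu]].
have := degS x; have := optimal_deg oM xM.
have tri a b d : adj a d -> adj b d -> x != d -> ~~ (adj x a && adj x b) || (a == b).
  move=> ad bd xd; rewrite -implybE; apply/implyP => /andP[xa xb].
  by apply/eqP/(uniq_nbr xd) => //; apply: sym.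
have n1 : ~~ (adj x z && adj x w).
  by have := tri z w c zc wc xc; rewrite (negbTE (adj_neq zw)) orbF.
have n2 : ~~ (adj x z && adj x c).
  by have := tri z c w zw (sym _ _ wc) xw; rewrite (negbTE (adj_neq zc)) orbF.
have n3 : ~~ (adj x w && adj x c).
  by have := tri w c z (sym _ _ zw) (sym _ _ zc) xz; rewrite (negbTE (adj_neq wc)) orbF.
have n4 : ~~ (adj x z && adj x r).
  by have := tri z r w zw (sym _ _ wr) xw; rewrite (negbTE (ne z r dzM drM)) orbF.
have n5 : ~~ (adj x z && adj x u).
  by have := tri z u c zc (sym _ _ cuA) xc; rewrite (negbTE zu) orbF.
have n6 : ~~ (adj x w && adj x v).
  by have := tri w v z (sym _ _ zw) (sym _ _ zv) xz; rewrite (negbTE (ne w v dwM dvM)) orbF.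
have n7 : ~~ (adj x w && adj x u).
  by have := tri w u c wc (sym _ _ cuA) xc; rewrite (negbTE wu) orbF.
have n8 : ~~ (adj x c && adj x v).
  by have := tri c v z (sym _ _ zc) (sym _ _ zv) xz; rewrite (negbTE (ne c v dcM dvM)) orbF.
have n9 : ~~ (adj x c && adj x r).
  by have := tri c r w (sym _ _ wc) (sym _ _ wr) xw; rewrite (negbTE (ne c r dcM drM)) orbF.
(* A tight [x] misses the triangle, as it would make a fork of its neighbour
   there; an [x] of degree [s + 1] misses one of any two tight vertices, not being
   a fork, and one end of each pendant edge, since [M] stays loose when the tight
   end is deleted. *)
have one a b : a \in M -> b \in M -> deg_in M a = s.+1 -> deg_in M b = s ->
    adj a b -> x != b -> deg_in M x = s -> ~~ adj x a.
  move=> aM bM da db ab xb dx; apply: contra xb => xa; apply/eqP.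
  by apply: (nM a) => //; apply: sym.
have two a b : a \in M -> b \in M -> deg_in M a = s -> deg_in M b = s ->
    a != b -> deg_in M x = s.+1 -> ~~ (adj x a && adj x b).
  by move=> aM bM da db ab dx; apply: contra ab => /andP[xa xb]; apply/eqP/(nM x).
have mid a b : a \in M -> b \in M -> deg_in M a = s.+1 -> deg_in M b = s ->
    adj a b -> x != b -> deg_in M x = s.+1 -> ~~ (adj x a && adj x b).
  move=> aM bM da db ab xb dx; apply/negP => /andP[xa xbA].
  have [_ /(_ x a)] := forkless_loose_del gM bM db.
  have := deg_in_del x bM; have := deg_in_del a bM.
  rewrite !in_setD1 xb adj_neq // xM aM dx da ab xbA xa !add1n => -[<-] -[<-].
  by move/(_ isT isT erefl erefl).
have [dx|dx] := eqVneq (deg_in M x) s.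
  rewrite (negbTE (one z v _ _ _ _ _ _ _)) // (negbTE (one w r _ _ _ _ _ _ _)) //.
  rewrite (negbTE (one c u _ _ _ _ _ _ _)) // (negbTE (iM x v _ _ _ _)) //.
  by rewrite (negbTE (iM x r _ _ _ _)) // (negbTE (iM x u _ _ _ _)) // dx; clear; lia.
have [dx1|dx1] := eqVneq (deg_in M x) s.+1.
  have := two v r vM rM dvM drM vr dx1; have := two v u vM uM dvM du vu dx1.
  have := two r u rM uM drM du ru dx1; have := mid z v zM vM dzM dvM zv xv dx1.
  have := mid w r wM rM dwM drM wr xr dx1; have := mid c u cM uM dcM du cuA xu dx1.
  move: n1 n2 n3 n4 n5 n6 n7 n8 n9; rewrite dx1; clear.
  by case: (adj x z); case: (adj x w); case: (adj x c); case: (adj x v);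
     case: (adj x r); case: (adj x u) => //= *; lia.
(* Deleting [v] would turn such an [x] into a fork adjacent to [v]. *)
have three : deg_in M x = s.+2 -> ~~ [&& adj x v, adj x r & adj x u].
  move=> dx2; apply/and3P => -[xvA xrA xuA].
  have := fork_avoid gM vM dvM (z := x) (v1 := r) (v2 := u).
  rewrite !in_setD1 xv xM eq_sym vr rM (eq_sym u) vu uM ru xrA xuA xvA.
  have := deg_in_del x vM; have := deg_in_del r vM; have := deg_in_del u vM.
  rewrite dx2 drM du xvA !(adjC _ v) (negbTE nvr) (negbTE vuA) !add0n add1n.
  by move=> <- <- [<-]; do 9!move/(_ erefl).
have [dx2|dx2] := eqVneq (deg_in M x) s.+2.
  move: (three dx2) n1 n2 n3 n4 n5 n6 n7 n8 n9; rewrite dx2; clear.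
  by case: (adj x z); case: (adj x w); case: (adj x c); case: (adj x v);
     case: (adj x r); case: (adj x u) => //= *; lia.
move: dx dx1 dx2 n1 n2 n3 n4 n5 n6 n7 n8 n9; clear.
by case: (adj x z); case: (adj x w); case: (adj x c); case: (adj x v);
   case: (adj x r); case: (adj x u) => //= *; lia.
Qed.

Lemma no_forkless M : ~ forkless M.
Proof.
have [n] := ubnP #|M|; elim: n M => // n IHn M /ltnSE leMn gM.
have [[oM _] _] := gM; have [x xM dx] := optimal_tight oM.
by apply: (IHn _ _ (forkless_del gM xM dx)); rewrite (cardsD1 x) xM in leMn.
Qed.

(** * A stable subset *)
Hypothesis W_n0 : W != set0.
Hypothesis W_deg : {in W, forall x, s < deg_in W x}.

Lemma W_not_meager : ~~ meager W.
Proof. exact: strict_not_meager (subxx _) W_n0 W_deg. Qed.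

(** A feasible set of minimal cardinality is meager: from a subset with all
    degrees above [s] one more vertex could be deleted. *)
Lemma viable_exists : exists A, viable A.
Proof.
have fW : (W \subset W) && (W != set0) && feasible W.
  by rewrite subxx W_n0; apply/feasibleP => x /W_deg/ltnW.
case: (arg_minnP (P := fun Z : {set G} =>
          (Z \subset W) && (Z != set0) && feasible Z)
                 (fun Z : {set G} => #|Z|) fW) => Z /andP[/andP[sZW Z0] fZ] minZ.
exists Z; apply: (viableI sZW _ (subxx _) Z0 fZ); apply/negPn/negP => /not_meager.
case=> K [sKZ /set0Pn[y yK] KP]; have [fK K0] := strict_del_feasible yK KP.
have := minZ (K :\ y); rewrite fK K0 (subset_trans (subsetDl _ _)) ?(subset_trans sKZ) //.
move=> /(_ isT) le; have := subset_leq_card sKZ; rewrite (cardsD1 y) yK.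
by rewrite leqNgt add1n ltnS le.
Qed.

Lemma optimal_exists_max : exists2 A, optimal A & forall X, optimal X -> #|X| <= #|A|.
Proof.
have [A0 vA0] := viable_exists.
case: (arg_maxnP weight vA0) => A1 vA1 maxA1.
have oA1 : optimal A1.
  by rewrite /optimal vA1; apply/forallP => X; apply/implyP => /maxA1.
by case: (arg_maxnP (fun A : {set G} => #|A|) oA1) => A oA maxA; exists A.
Qed.

(** An optimal set of maximal cardinality works: by [no_forkless] it is enough
    to see that otherwise it would be forkless. *)
Lemma exists_stable_subset : exists A, [/\ A \proper W, A != set0,
  {in A, forall x, s <= deg_in A x} & {in W :\: A, forall x, deg_in A x < s}].
Proof.
have [A oA maxA] := optimal_exists_max.
have mA := optimal_meager oA; have fA := optimal_feasible oA.
have A0 : A != set0.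
  have /and3P[_ _ /existsP[Z /and3P[sZA Z0 _]]] := optimal_viable oA.
  by apply: contraNneq Z0 => A0; rewrite -subset0 -A0.
have pAW : A \proper W.
  rewrite properEneq (optimal_sub oA) andbT.
  by apply: contraNneq W_not_meager => <-.
exists A; split=> //; first exact/feasibleP.
move=> y; rewrite inE => /andP[yA yW]; rewrite ltnNge; apply/negP => dy.
have nmAy : ~~ meager (y |: A).
  apply/negP => mAy.
  have vAy : viable (y |: A).
    apply: (viableI _ mAy (subsetU1 y A) A0 fA).
    by rewrite subUset sub1set yW optimal_sub.
  have oAy : optimal (y |: A).
    apply: (optimal_heavy oA vAy); have := weight_del (setU11 y A).
    by rewrite setU1K // deg_in_add // adj_irrefl; move: dy; clear; lia.
  by have := maxA _ oAy; rewrite cardsU1 yA ltnn.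
have [K [sK K0 KP]] := not_meager nmAy.
have lA := strict_loose oA yA sK K0 KP.
have [_ iA] := lA.
(* [v] is not in [K] unless it is adjacent to [y], so [K] would also make
   [A :\ v] loose, while [z] and [w] are adjacent and tight there. *)
suff tight_adj z v w : z \in A -> v \in A -> w \in A -> deg_in A z = s.+1 ->
    deg_in A v = s -> deg_in A w = s -> v != w -> adj z v -> adj z w -> adj y v.
  apply: (@no_forkless A); split=> // z v w zA vA wA dz dv dw zv zw.
  apply/eqP/negPn/negP => vw.
  have yv := tight_adj z v w zA vA wA dz dv dw vw zv zw.
  have yw : adj y w by apply: (tight_adj z w v) => //; rewrite eq_sym.
  case/eqP: vw; apply: (uniq_nbr (x := y) (y := z)) => //.
  by apply: contraNneq yA => ->.
move=> zA vA wA dz dv dw vw zv zw; apply: contraT => nyv.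
have vK : v \notin K.
  apply/negP => vK; have := KP v vK; have := deg_in_sub v sK.
  by rewrite deg_in_add // adjC (negbTE nyv) dv; clear; lia.
have oAv := loose_del lA vA dv.
have [] : loose (A :\ v).
  apply: (strict_loose (y := y) oAv _ _ K0 KP); first by rewrite !inE negb_and yA orbT.
  apply/subsetP => x xK; have := subsetP sK x xK; rewrite !inE => /orP[->//|->].
  by rewrite andbT orbC; apply/orP; left; apply: contraNneq vK => <-.
move=> _ /(_ z w); rewrite !inE zA wA adj_neq // eq_sym vw zw.
have := deg_in_del z vA; have := deg_in_del w vA; have := iA w v wA vA dw dv.
rewrite dz zv dw => /negbTE-> e1 []; rewrite add0n => e2.
by move/(_ isT isT (esym e2) (esym e1)).
Qed.

End Landscape.

(** * From one stable subset to the partition *)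
Lemma C4_free_uniq_nbr (G : sgraph) : ~ has_subgraph C4 G ->
  forall x y u v : G, x != y ->
    adj x u -> adj y u -> adj x v -> adj y v -> u = v.
Proof.
move=> noC4 x y u v xy xu yu xv yv; apply/eqP/negPn/negP => uv; apply: noC4.
pose f (i : 'I_4) : G := nth x [:: x; u; y; v] i.
have s1 := adj_neq xu; have s2 := adj_neq yu; have s3 := adj_neq xv; have s4 := adj_neq yv.
exists f; split.
  have un : uniq [:: x; u; y; v].
    by rewrite /= !inE !negb_or s1 xy s3 uv (eq_sym u) s2 s4.
  by move=> i j /eqP; rewrite /f nth_uniq // => /eqP/val_inj.
have sym (a b : G) : adj a b -> adj b a by rewrite adjC.
by case=> [[|[|[|[|//]]]] ?]; case=> [[|[|[|[|//]]]] ?] //= _; rewrite /f //=; apply: sym.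
Qed.

(** The hypothesis [1 < s i] for the remaining parts is what makes their total
    demand at least [2], so that the degrees in [W] exceed [s ord0] as
    [exists_stable_subset] requires. A vertex outside the first part loses at
    most [s ord0 - 1] neighbours, which matches the decrease of the bound. *)
Lemma partition_degrees (G : sgraph)
    (uniq_nbr : forall x y u v : G, x != y ->
       adj x u -> adj y u -> adj x v -> adj y v -> u = v)
    (k : nat) (s : 'I_k.+1 -> nat) (W : {set G}) :
  (forall i, 1 < s i) -> W != set0 ->
  {in W, forall x, \sum_i s i - k <= deg_in W x} ->
  exists V : 'I_k.+1 -> {set G},
    [/\ forall i, V i != set0, forall i j, i != j -> [disjoint V i & V j],
      \bigcup_i V i = W & forall i, {in V i, forall x, s i <= deg_in (V i) x}].
Proof.
elim: k s W => [|k IHk] s W s2 W0 dW.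
  exists (fun=> W); split=> //; first by move=> i j; rewrite !ord1.
    by rewrite big_ord1.
  by move=> i x /dW; rewrite big_ord1 subn0 ord1.
pose s' (i : 'I_k.+1) := s (lift ord0 i).
have sum_s : \sum_i s i = s ord0 + \sum_i s' i by rewrite big_ord_recl.
have sum_s' : k.+1.*2 <= \sum_i s' i.
  have -> : k.+1.*2 = \sum_(i < k.+1) 2 by rewrite sum_nat_const card_ord muln2.
  by apply: leq_sum => i _; apply: s2.
have [|A [/andP[sAW nWA] A0 dA dB]] := exists_stable_subset uniq_nbr (s2 ord0) W0.
  by move=> x /dW; move: sum_s sum_s'; clear; lia.
have B0 : W :\: A != set0 by rewrite setD_eq0.
have [i|x /[dup] xB|V [Vn0 Vd VU Vs]] := IHk s' (W :\: A) _ B0.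
- exact: s2.
- have := dB x xB; rewrite inE => + /andP[_ xW]; have := dW x xW.
  by rewrite (deg_inD x sAW); move: sum_s; clear; lia.
have VA i : [disjoint A & V i].
  rewrite disjoint_sym disjoints_subset; apply/subsetP => x xV.
  have : x \in W :\: A by rewrite -VU; apply/bigcupP; exists i.
  by rewrite !inE => /andP[].
exists (fun i => oapp V A (unlift ord0 i)); split.
- by move=> i; case: unliftP => [j _|_] /=.
- move=> i j; case: unliftP => [i' ->|->]; case: unliftP => [j' ->|->] //= ij.
  + by apply: Vd; apply: contraNneq ij => ->.
  + by rewrite disjoint_sym.
- rewrite big_ord_recl unlift_none /=.
  under eq_bigr => i _ do rewrite liftK /=.
  rewrite VU; apply/setP => x; rewrite !inE.
  by case: (boolP (x \in A)) => //= /(subsetP sAW)->.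
- by move=> i; case: unliftP => [j ->|->] //=; apply: Vs.
Qed.

Lemma degree_induced (G : sgraph) (A : {set G}) (x : induced A) :
  degree x = deg_in A (val x).
Proof.
rewrite /degree /deg_in -(card_imset _ val_inj); apply: eq_card => u.
rewrite inE; apply/imsetP/andP => [[v + ->]|[uA xu]].
  by rewrite inE => xv; split=> //; apply: valP.
by exists (exist _ u uA); rewrite ?inE.
Qed.

Theorem corollary4 (k : nat) (hk : 2 <= k)
    (s : 'I_k -> nat) (hs : forall i : 'I_k, 2 <= s i)
    (G : sgraph) (G_nonempty : 0 < #|G|)
    (G_C4_free : ~ has_subgraph C4 G)
    (G_min_degree : (\sum_(i < k) s i) - (k - 1) <= min_degree G) :
  exists V : 'I_k -> {set G},
    is_partition V /\ (forall i : 'I_k, s i <= min_degree (induced (V i))).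
Proof.
case: k hk s hs G_min_degree => // k _ s hs; rewrite subn1 /= => G_min_degree.
have degG (x : G) : deg_in [set: G] x = degree x.
  by apply: eq_card => u; rewrite !inE.
have [||V [Vn0 Vd VU Vs]] := partition_degrees (C4_free_uniq_nbr G_C4_free) (W := [set: G]) hs.
- by rewrite -card_gt0 cardsT.
- by move=> x _; rewrite degG; apply: (leq_min_degree _ G_nonempty).
exists V; split=> // i; apply/leq_min_degree => [|x].
  by rewrite card_sig; have := Vn0 i; rewrite -card_gt0; congr (0 < _); apply: eq_card.
by rewrite degree_induced; apply: Vs; apply: valP.
Qed.
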